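(* For any fixed $n\ge 1$, the sequences $$\ell_{n,1}^{\mathrm{hook}},\ \ell_{n,2}^{\mathrm{hook}},\dots,\ell_{n,n}^{\mathrm{hook}}\quad\text{and}\quad i_{n,1}^{\mathrm{hook}},\ i_{n,2}^{\mathrm{hook}},\dots,i_{n,n}^{\mathrm{hook}}$$ are log concave.
   Context: $\mathfrak S_n$ is the set of permutations of $[n]=\{1,\dots,n\}$. For $\pi\in\mathfrak S_n$, $\ell(\pi)$ is the length of a longest increasing subsequence of $\pi$ (in one-line notation). The shape $\operatorname{sh}\pi$ is the common shape (a partition of $n$) of the two standard Young tableaux associated with $\pi$ by the Robinson–Schensted correspondence. Let $\mathrm{hook}$ be the set of all hook partitions of $n$, i.e. those of the form $(k,1^{n-k})$ with $1\le k\le n$ (first part $k$ followed by $n-k$ parts equal to $1$). Then $\ell_{n,k}^{\mathrm{hook}}$ is the number of $\pi\in\mathfrak S_n$ with $\ell(\pi)=k$ and $\operatorname{sh}\pi\in\mathrm{hook}$, and $i_{n,k}^{\mathrm{hook}}$ is the number of involutions $\pi\in\mathfrak S_n$ (permutations whose square is the identity) with $\ell(\pi)=k$ and $\operatorname{sh}\pi\in\mathrm{hook}$. A sequence of real numbers $l_1,\dots,l_n$ is log concave if $l_{k-1}l_{k+1}\le l_k^2$ for all $1\le k\le n$, with the convention $l_0=l_{n+1}=0$. *)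

(* Defs.v *)
From HB Require Import structures.
From mathcomp Require Import all_boot all_order all_algebra all_fingroup.

Set Implicit Arguments.
Unset Strict Implicit.
Unset Printing Implicit Defensive.

Import Order.TTheory GRing.Theory Num.Theory.

(* One-line notation pi(1) ... pi(n); 'S_n acts on {0, .., n-1}, hence the
   successors. *)
Definition one_line (n : nat) (s : 'S_n) : seq nat :=
  [seq (s i : nat).+1 | i <- enum 'I_n].

(* A subsequence of w is given by the mask m of the positions it keeps. *)
Definition lis (w : seq nat) : nat :=
  \max_(m : (size w).-tuple bool | sorted ltn (mask m w)) size (mask m w).

(* Tableaux are lists of rows, top row first.  The second component of
   row_insert is the bumped entry, if any; that of tab_insert is the index of
   the row in which the new cell is created. *)
Fixpoint row_insert (x : nat) (r : seq nat) : seq nat * option nat :=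
  if r is y :: r1 then
    if x < y then (x :: r1, Some y)
    else let: (r2, b) := row_insert x r1 in (y :: r2, b)
  else ([:: x], None).

Fixpoint tab_insert (x : nat) (t : seq (seq nat)) : seq (seq nat) * nat :=
  if t is r :: t1 then
    let: (r1, b) := row_insert x r in
    if b is Some y then let: (t2, i) := tab_insert y t1 in (r1 :: t2, i.+1)
    else (r1 :: t1, 0)
  else ([:: [:: x]], 0).

Definition tab_add (i m : nat) (t : seq (seq nat)) : seq (seq nat) :=
  set_nth [::] t i (rcons (nth [::] t i) m).

Definition RS_step (PQ : seq (seq nat) * seq (seq nat)) (xm : nat * nat) :=
  let: (P, i) := tab_insert xm.1 PQ.1 in (P, tab_add i xm.2 PQ.2).

(* The pair (P, Q) of insertion and recording tableaux. *)
Definition RS (w : seq nat) : seq (seq nat) * seq (seq nat) :=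
  foldl RS_step ([::], [::]) (zip w (iota 1 (size w))).

Definition sh (n : nat) (s : 'S_n) : seq nat := shape (RS (one_line s)).1.

Lemma shape_tab_insert x t u m : shape u = shape t ->
  shape (tab_add (tab_insert x t).2 m u) = shape (tab_insert x t).1.
Proof.
have row y r : let: (r1, b) := row_insert y r in
    size r1 = (if b is Some _ then size r else (size r).+1).
  elim: r => //= z r IHr; case: ifP => //= _.
  by case: (row_insert y r) IHr => r1 [c|] /= ->.
elim: t x u => [|r t IHt] x [|q u] //= [eq_qr eq_ut].
have := row x r; case: (row_insert x r) => r1 [y|] szr1; last first.
  by rewrite /tab_add /shape /= size_rcons szr1 eq_qr -!/(shape _) eq_ut.
have := IHt y u eq_ut; case: (tab_insert y t) => t2 i /= IH.
by rewrite /tab_add /shape /= szr1 eq_qr; congr (_ :: _).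
Qed.

Lemma shape_RS w : shape (RS w).2 = shape (RS w).1.
Proof.
rewrite /RS; move: (zip w _) => v.
have: shape (([::], [::]) : seq (seq nat) * seq (seq nat)).2
    = shape (([::], [::]) : seq (seq nat) * seq (seq nat)).1 by [].
elim: v (_, _) => //= xm v IHv PQ eqPQ; apply: IHv.
rewrite /RS_step; have := shape_tab_insert xm.1 xm.2 eqPQ.
by case: (tab_insert _ _).
Qed.

Definition hook (n : nat) (la : seq nat) : bool :=
  [exists k : 'I_n.+1, (0 < k) && (la == (k : nat) :: nseq (n - k) 1)].

Definition ell_hook (n k : nat) : nat :=
  #|[set s : 'S_n | (lis (one_line s) == k) && hook n (sh s)]|.

Definition inv_hook (n k : nat) : nat :=
  #|[set s : 'S_n | [&& (s * s == 1)%g, lis (one_line s) == k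
                      & hook n (sh s)]]|.

Local Open Scope ring_scope.

(* l_1, .., l_n, extended by 0 outside of [1, n]; the values of l there are
   ignored. *)
Definition pad (R : realDomainType) (n : nat) (l : nat -> R) (k : nat) : R :=
  if (1 <= k <= n)%N then l k else 0.

Definition log_concave (R : realDomainType) (n : nat) (l : nat -> R) : Prop :=
  forall k : nat, (1 <= k <= n)%N ->
    pad n l k.-1 * pad n l k.+1 <= pad n l k ^+ 2.

(* Main.v *)
(* The words whose Robinson-Schensted shape is a hook are those with an
   increasing and a decreasing subsequence that share a letter and together
   cover the word; this condition is invariant under inversion of permutations.
   Along the insertion of such a word, the first row and the leg of P evolve by
   a reversible rule, so the permutations of hook shape (k, 1^(n-k)) are in
   bijection with the pairs of (n-k)-subsets of an (n-1)-set: the leg of P is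
   the descent set of the inverse permutation, and the leg of Q the descent set
   of the permutation. Inversion swaps the two sets, hence
   ell_(n,k) = C(n-1, n-k)^2 and i_(n,k) = C(n-1, n-k). *)
Require Import Defs.
From mathcomp Require Import all_boot all_order all_algebra all_fingroup zify.

Set Implicit Arguments.
Unset Strict Implicit.
Unset Printing Implicit Defensive.

(** * Insertion within hook shapes *)

Definition insertion (w : seq nat) : seq (seq nat) :=
  foldl (fun t x => (tab_insert x t).1) [::] w.

Lemma insertion_rcons w x :
  insertion (rcons w x) = (tab_insert x (insertion w)).1.
Proof. by rewrite /insertion -cats1 foldl_cat. Qed.

Lemma RS_insertion w : (RS w).1 = insertion w.
Proof.
suff RS_fold v P Q : size w <= size v ->
    (foldl RS_step (P, Q) (zip w v)).1 = foldl (fun t x => (tab_insert x t).1) P w.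
  by rewrite /RS RS_fold ?size_iota.
elim: w v P Q => [|x w IHw] [|m v] //= P Q le_wv.
by rewrite {2}/RS_step /=; case: tab_insert => P' i /=; rewrite IHw.
Qed.

Lemma row_insert_append x r : all (gtn x) r -> row_insert x r = (rcons r x, None).
Proof.
elim: r => //= y r IHr /andP[lt_yx /IHr->].
by rewrite ltnNge ltnW.
Qed.

Lemma row_insert_bump x r1 y r2 : all (gtn x) r1 -> x < y ->
  row_insert x (r1 ++ y :: r2) = (r1 ++ x :: r2, Some y).
Proof.
move=> + lt_xy; elim: r1 => [|z r1 IHr] /=; first by rewrite lt_xy.
by case/andP=> lt_zx /IHr->; rewrite ltnNge ltnW.
Qed.

Variant row_insert_spec x r : Prop :=
| RowAppend of all (gtn x) r
| RowBump r1 y r2 of r = r1 ++ y :: r2 & all (gtn x) r1 & x < y.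

Lemma row_insertP x r : x \notin r -> row_insert_spec x r.
Proof.
elim: r => [|z r IHr]; first by left.
rewrite inE negb_or => /andP[ne_xz /IHr{IHr}IHr].
have [lt_xz|lt_zx|eq_xz] := ltngtP x z; last by rewrite eq_xz eqxx in ne_xz.
  exact: (@RowBump _ _ [::] z r).
case: IHr => [r_x|r1 y r2 -> r1_x lt_xy]; first by left; rewrite /= lt_zx.
by apply: (@RowBump _ _ (z :: r1) y r2) => //=; rewrite lt_zx.
Qed.

Definition hook_tab (r L : seq nat) : seq (seq nat) :=
  r :: [seq [:: y] | y <- L].

(** Every row of the leg has one cell, so each entry is bumped by the one arriving from above and
    the leg slides down by one row. *)
Lemma tab_insert_leg y L : path ltn y L ->
  (tab_insert y [seq [:: z] | z <- L]).1 = [seq [:: z] | z <- y :: L].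
Proof.
elim: L y => //= z L IHL y /andP[lt_yz /IHL]; rewrite lt_yz /=.
by case: tab_insert => t i /= ->.
Qed.

Lemma tab_insert_append x r L : all (gtn x) r ->
  (tab_insert x (hook_tab r L)).1 = hook_tab (rcons r x) L.
Proof. by move=> r_x /=; rewrite row_insert_append. Qed.

Lemma tab_insert_bump x r1 y r2 L : all (gtn x) r1 -> x < y -> path ltn y L ->
  (tab_insert x (hook_tab (r1 ++ y :: r2) L)).1
  = hook_tab (r1 ++ x :: r2) (y :: L).
Proof.
move=> r1_x lt_xy /tab_insert_leg /=; rewrite row_insert_bump //.
by case: tab_insert => t i /= ->.
Qed.

Lemma size_row_insert x r : size r <= size (row_insert x r).1.
Proof.
by elim: r => //= y r IHr; case: ifP => //= _; case: row_insert IHr.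
Qed.

(** Rows never shrink, so a second row of length two, once present, keeps all later shapes from
    being hooks. *)
Lemma shape_tab_insert_mono x t i :
  nth 0 (shape t) i <= nth 0 (shape (tab_insert x t).1) i.
Proof.
elim: t x i => [|r t IHt] x i; first by rewrite nth_nil.
have /= := size_row_insert x r; case: row_insert => r1 [y|] /= le_r.
  by case: tab_insert (IHt y) => t2 j /= IH; case: i.
by case: i => [|i] /=.
Qed.

(* [hooked w r L b]: inserting the letters of [w] keeps a hook shape throughout
   and ends with first row [r] and leg [L]; [b] records for each letter but the
   first whether the row (true) or the leg (false) grew. *)
Inductive hooked : seq nat -> seq nat -> seq nat -> bitseq -> Prop :=
| HookStart x : hooked [:: x] [:: x] [::] [::]
| HookAppend w r L b x : hooked w r L b -> all (gtn x) r -> x \notin w ->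
    hooked (rcons w x) (rcons r x) L (rcons b true)
| HookBump w r1 y r2 L b x : hooked w (r1 ++ y :: r2) L b ->
    all (gtn x) r1 -> x < y -> path ltn y L -> x \notin w ->
    hooked (rcons w x) (r1 ++ x :: r2) (y :: L) (rcons b false).

Lemma hooked_insertion w r L b : hooked w r L b -> insertion w = hook_tab r L.
Proof.
elim=> {w r L b} [x|w r L b x _ IH r_x _|w r1 y r2 L b x _ IH r1_x xy yL _] //.
  by rewrite insertion_rcons IH tab_insert_append.
by rewrite insertion_rcons IH tab_insert_bump.
Qed.

Lemma hooked_perm w r L b : hooked w r L b -> perm_eq w (r ++ L).
Proof.
elim=> {w r L b} [x|w r L b x _ IH r_x _|w r1 y r2 L b x _ IH r1_x xy yL _] //;
  apply/seq.permP=> p; move/seq.permP/(_ p): IH; rewrite -?cats1 !count_cat /=; lia.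
Qed.

Lemma hooked_uniq w r L b : hooked w r L b -> uniq w.
Proof.
elim=> {w r L b} [x|w r L b x _ IH r_x xw|w r1 y r2 L b x _ IH r1_x xy yL xw] //.
  by rewrite rcons_uniq xw.
by rewrite rcons_uniq xw.
Qed.

Lemma hooked_mem w r L b z : hooked w r L b -> (z \in w) = (z \in r) || (z \in L).
Proof. by move/hooked_perm/perm_mem->; rewrite mem_cat. Qed.

Lemma hooked_size w r L b : hooked w r L b -> size w = size r + size L.
Proof. by move/hooked_perm/perm_size->; rewrite size_cat. Qed.

Lemma sorted_cat_mid (T : eqType) (e : rel T) (r1 r2 : seq T) y : transitive e ->
  sorted e (r1 ++ y :: r2) =
  [&& sorted e r1, sorted e r2, all (e^~ y) r1 , all (e y) r2
    & allrel e r1 r2].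
Proof.
move=> e_tr; rewrite !(sorted_pairwise e_tr) pairwise_cat /= allrel_consr.
by case: (all (e^~ y) r1); case: (allrel e r1 r2); case: (pairwise e r1);
  case: (all (e y) r2); case: (pairwise e r2).
Qed.

(** The witness [c] records that the leg starts above some row entry. After a bump the new letter
    serves, being smaller than the bumped [y] that now heads the leg. *)
Lemma hooked_sorted w r L b : hooked w r L b ->
  [/\ sorted ltn r, sorted ltn L & exists2 c, c \in r & path ltn c L].
Proof.
have tr := ltn_trans.
elim=> {w r L b} [x|w r L b x _ [IHr IHL [c cr cL]] r_x _|].
- by split=> //; exists x; rewrite ?mem_head.
- split=> //; last by exists c; rewrite // mem_rcons inE cr orbT.
  by rewrite -cats1 sorted_cat_mid //= IHr allrel0r /= !andbT.
move=> w r1 y r2 L b x _ [IHr IHL _] r1_x xy yL _; split=> //.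
  move: IHr; rewrite !sorted_cat_mid // => /and5P[-> -> _ yr2 ->].
  rewrite andbT /=; apply/andP; split=> //.
  by apply: sub_all yr2 => z /(ltn_trans xy).
by exists x; rewrite ?mem_cat ?mem_head ?orbT //= xy.
Qed.

(** * Monotone subsequences *)

Lemma subseq_rconsP (s w : seq nat) x : subseq s (rcons w x) ->
  subseq s w \/ exists2 s' : seq nat, s = rcons s' x & subseq s' w.
Proof.
rewrite -subseq_rev rev_rcons.
case/lastP: s => [|s y]; first by left; apply: sub0seq.
rewrite rev_rcons /=; case: eqP => [->|_]; rewrite -?rev_rcons subseq_rev.
  by right; exists s.
by left.
Qed.

Lemma subseq_rcons_rcons (T : eqType) (s w : seq T) x :
  subseq s w -> subseq (rcons s x) (rcons w x).
Proof. by move=> sw; rewrite -!cats1 cat_subseq. Qed.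

Lemma subseq_rconsr (T : eqType) (s w : seq T) x :
  subseq s w -> subseq s (rcons w x).
Proof. by move=> sw; apply: subseq_trans sw (subseq_rcons _ _). Qed.

Lemma sorted_rconsE (T : eqType) (e : rel T) s x : transitive e ->
  sorted e (rcons s x) = sorted e s && all (e^~ x) s.
Proof. by move=> e_tr; rewrite -cats1 sorted_cat_mid //= allrel0r !andbT. Qed.

Lemma gtn_trans : transitive gtn.
Proof. by move=> y x z /= yx zy; apply: ltn_trans zy yx. Qed.

Lemma ltn_sorted_uniq s : sorted ltn s -> uniq s.
Proof. exact: (sorted_uniq ltn_trans ltnn). Qed.

Lemma gtn_sorted_uniq s : sorted gtn s -> uniq s.
Proof. exact: (sorted_uniq gtn_trans ltnn). Qed.

Lemma subseq1_last (w : seq nat) x : subseq [:: x] (rcons w x).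
Proof. by rewrite sub1seq mem_rcons mem_head. Qed.

(** Schensted's argument: a letter entering the row at index [i] extends an increasing subsequence
    that ends at its smaller left neighbour, and entries at the other indices keep the subsequences
    they had. *)
Lemma hooked_increasing w r L b i : hooked w r L b -> i < size r ->
  exists J, [/\ subseq (rcons J (nth 0 r i)) w, sorted ltn (rcons J (nth 0 r i))
    & size J = i].
Proof.
have tr := ltn_trans; move=> h.
have extend J t x v : sorted ltn (rcons J t) -> t < x -> subseq (rcons J t) v ->
    subseq (rcons (rcons J t) x) (rcons v x) /\ sorted ltn (rcons (rcons J t) x).
  move=> sJ tx Jv; split; first exact: subseq_rcons_rcons.
  rewrite sorted_rconsE // sJ all_rcons /= tx /=.
  move: sJ; rewrite sorted_rconsE // => /andP[_].
  by apply: sub_all => u /= /ltn_trans->.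
elim: h i => {w r L b} [x|w r L b x hw IH r_x _|w s1 y s2 L b x hw IH s1_x xy yL _] i.
- by case: i => // _; exists [::]; rewrite /= eqxx.
- rewrite size_rcons ltnS nth_rcons => le_ir.
  have [lt_ir|ge_ir] := ltnP i (size r).
    by have [J [Jw sJ szJ]] := IH i lt_ir; exists J; split=> //; apply: subseq_rconsr.
  have ->: i = size r by apply/eqP; rewrite eqn_leq le_ir.
  rewrite eqxx; case: (posnP (size r)) => [->|r_gt0].
    by exists [::]; rewrite subseq1_last.
  have lt_pr : (size r).-1 < size r by rewrite prednK.
  have [J [Jw sJ szJ]] := IH _ lt_pr.
  have [|? ?] := extend J _ x w sJ _ Jw; first exact: (allP r_x _ (mem_nth _ lt_pr)).
  by eexists; split; first eassumption; rewrite // size_rcons szJ prednK.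
rewrite size_cat /= => lt_i.
have [eq_i|ne_i] := eqVneq i (size s1); last first.
  have eq_nth : nth 0 (s1 ++ x :: s2) i = nth 0 (s1 ++ y :: s2) i.
    rewrite !nth_cat; case: ltnP => // le_si.
    by case: (i - size s1) (subn_eq0 i (size s1)) => //; rewrite eqxx; lia.
  have [|J [Jw sJ szJ]] := IH i; first by rewrite size_cat.
  by rewrite eq_nth; exists J; split=> //; apply: subseq_rconsr.
rewrite eq_i nth_cat ltnn subnn /=; case: (posnP (size s1)) => [->|s1_gt0].
  by exists [::]; rewrite subseq1_last.
have lt_p : (size s1).-1 < size s1 by rewrite prednK.
have [|J] := IH (size s1).-1; first by rewrite size_cat /=; lia.
rewrite nth_cat lt_p => -[Jw sJ szJ].
have [|? ?] := extend J _ x w sJ _ Jw; first exact: (allP s1_x _ (mem_nth _ lt_p)).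
by eexists; split; first eassumption; rewrite // size_rcons szJ prednK.
Qed.

(* The last letter of this subsequence dominates every letter of the row that
   the next insertion may bump without leaving the hook shapes. *)
Lemma hooked_decreasing w r L b : hooked w r L b ->
  exists D z, [/\ subseq (rcons D z) w, sorted gtn (rcons D z), size D = size L
    & [/\ z \in r, {in r, forall t, path ltn t L -> t <= z}
        & {in D, forall d t, path ltn t L -> t < d}]].
Proof.
have tr := gtn_trans.
elim=> {w r L b} [x|w r L b x hw IH r_x _|w s1 y s2 L b x hw IH s1_x xy yL _].
- exists [::], x; rewrite /= eqxx mem_head; split=> //; split=> // t.
  by rewrite inE => /eqP->.
- have [D [z [Dw sD szD [zr z_max D_L]]]] := IH.
  (* If [x] lies below the leg it replaces [z] as last letter, since each letter of [D] exceeds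
     every value below the leg. Otherwise [x] is not among the entries to be dominated and the old
     subsequence stays. *)
  have [xL|xNL] := boolP (path ltn x L); last first.
    exists D, z; split=> //; first exact: subseq_rconsr.
    split=> // [|t]; rewrite mem_rcons inE ?zr ?orbT // => /orP[/eqP->|/z_max//].
    by rewrite (negPf xNL).
  have Dw' : subseq D w by apply: subseq_trans (subseq_rcons _ _) Dw.
  exists D, x; split=> //; first exact: subseq_rcons_rcons.
    rewrite sorted_rconsE //; move: sD; rewrite sorted_rconsE // => /andP[-> _] /=.
    by apply/allP => d /D_L/(_ x xL).
  split=> // [|t]; first by rewrite mem_rcons mem_head.
  by rewrite mem_rcons inE => /orP[/eqP->//|/(allP r_x) /ltnW].
have [D [z [Dw sD szD [zr z_max D_L]]]] := IH.
have yz : y <= z by apply: z_max => //; rewrite mem_cat mem_head orbT.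
have Dy d : d \in rcons D z -> y <= d.
  rewrite mem_rcons inE => /orP[/eqP->//|/D_L/(_ y yL)/ltnW//].
exists (rcons D z), x; split.
- exact: subseq_rcons_rcons.
- rewrite sorted_rconsE // sD; apply/allP => d /Dy; exact: leq_trans.
- by rewrite size_rcons szD.
split; first by rewrite mem_cat mem_head orbT.
  move=> t /[swap] /andP[/= ty _]; rewrite mem_cat inE => /or3P[|/eqP->//|ts2].
    by move/(allP s1_x)/ltnW.
  have [+ _ _] := hooked_sorted hw; rewrite sorted_cat_mid; last exact: ltn_trans.
  by case/and5P=> _ _ _ /allP/(_ t ts2) /= yt _; lia.
by move=> d /Dy yd t /andP[/= ty _]; apply: leq_trans ty yd.
Qed.

Lemma hooked_row_bump w r1 y r2 L b x : hooked w (r1 ++ y :: r2) L b ->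
  all (gtn x) r1 -> x < y -> all (leq y) r2.
Proof.
case/hooked_sorted; rewrite sorted_cat_mid; last exact: ltn_trans.
by case/and5P=> _ _ _ yr2 _ _ _ _ _; apply: sub_all yr2 => t /ltnW.
Qed.

(** The clause on equality strengthens the induction and is reused in [hooked_or_short]: a longest
    [J] reaches at least the top of the row, so a letter that bumps cannot extend it. *)
Lemma hooked_increasing_max w r L b (J : seq nat) :
  hooked w r L b -> subseq J w -> sorted ltn J ->
  size J <= size r /\
  (size J = size r -> exists2 j, j \in J & all (geq j) r).
Proof.
have tr := ltn_trans => h; elim: h J => {w r L b} [x|w r L b x hw IH r_x _
    |w r1 y r2 L b x hw IH r1_x xy yL xw] J.
- case: J => [|z [|? ?]] //; last by rewrite /=; case: ifP.
  rewrite sub1seq mem_seq1 => /eqP-> _; split=> // _; exists x; first exact: mem_head.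
  by rewrite /= leqnn.
- case/subseq_rconsP=> [Jw|[J1 -> J1w]]; rewrite ?sorted_rconsE // => sJ.
    have [le_J _] := IH _ Jw sJ; rewrite size_rcons; split; first exact: leqW.
    by move=> eq_J; rewrite eq_J ltnn in le_J.
  case/andP: sJ => sJ _; have [le_J _] := IH _ J1w sJ; rewrite !size_rcons.
  split=> // _; exists x; first by rewrite mem_rcons mem_head.
  by rewrite all_rcons /= leqnn; apply: sub_all r_x => t /ltnW.
have yr2 := hooked_row_bump hw r1_x xy; rewrite size_cat /=.
case/subseq_rconsP=> [Jw|[J1 -> J1w]]; rewrite ?sorted_rconsE // => sJ.
  have := IH _ Jw sJ; rewrite size_cat /= => -[le_J ex_j]; split=> // /ex_j[j jJ].
  rewrite all_cat /= => /and3P[jr1 jy jr2]; exists j => //.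
  by rewrite all_cat /= jr1 jr2 andbT; apply: leq_trans (ltnW xy) jy.
case/andP: sJ => sJ /allP J_x.
(* All letters of [J1] are below [x], while [y], [r2] and the leg lie above [x]. *)
have Jr1 : {subset J1 <= r1}.
  move=> t tJ; have /= tx := J_x t tJ.
  have := mem_subseq J1w tJ; rewrite (hooked_mem _ hw) mem_cat inE -!orbA.
  case/or4P=> // [/eqP|/(allP yr2)|/(allP (order_path_min tr yL))] /=; lia.
have le_J : size J1 <= size r1 := uniq_leq_size (ltn_sorted_uniq sJ) Jr1.
rewrite size_rcons; split=> [|eq_J]; first by lia.
exists x; first by rewrite mem_rcons mem_head.
have ->: r2 = [::] by apply: size0nil; lia.
by rewrite all_cat /= leqnn !andbT; apply: sub_all r1_x => t /ltnW.
Qed.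

(** The clause on equality says that a longest [D] descends to or below some row entry that lies
    under the leg; this limits which new letters can extend [D]. *)
Lemma hooked_decreasing_max w r L b (D : seq nat) :
  hooked w r L b -> subseq D w -> sorted gtn D ->
  size D <= (size L).+1 /\
  (size D = (size L).+1 -> exists2 z, z \in r &
     path ltn z L /\ has (geq z) D).
Proof.
have tr := gtn_trans => h; elim: h D => {w r L b} [x|w r L b x hw IH r_x xw
    |w r1 y r2 L b x hw IH r1_x xy yL xw] D.
- case: D => [|z [|? ?]] //; last by rewrite /=; case: ifP.
  rewrite sub1seq mem_seq1 => /eqP-> _; split=> // _; exists x; first exact: mem_head.
  by rewrite /= leqnn.
- case/subseq_rconsP=> [Dw|[D1 -> D1w]]; rewrite ?sorted_rconsE // => sD.
    have [le_D ex_z] := IH _ Dw sD; split=> // /ex_z[z zr zL].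
    by exists z; rewrite // mem_rcons inE zr orbT.
  case/andP: sD => sD /allP D_x.
  (* The row lies below [x] and [D1] above it. If [D1] also has the length of the leg, it exhausts
     the leg, so the leg lies above [x]. *)
  have DL : {subset D1 <= L}.
    move=> t tD; have /= xt := D_x t tD.
    have := mem_subseq D1w tD; rewrite (hooked_mem _ hw) => /orP[/(allP r_x)|] //=.
    lia.
  have uD := gtn_sorted_uniq sD.
  rewrite size_rcons ltnS; split=> [|[eq_D]]; first exact: uniq_leq_size.
  have [_ sL _] := hooked_sorted hw.
  exists x; first by rewrite mem_rcons mem_head.
  split; last first.
    by rewrite has_rcons /= leqnn.
  rewrite (path_sortedE ltn_trans) sL andbT; apply/allP => t tL.
  suff tD : t \in D1 by exact: D_x.
  by rewrite (uniq_min_size uD DL _).2 // eq_D.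
case/subseq_rconsP=> [Dw|[D1 -> D1w]]; rewrite ?sorted_rconsE // => sD.
  have [le_D _] := IH _ Dw sD; split=> [|eq_D]; first exact: leqW.
  by rewrite eq_D ltnn in le_D.
case/andP: sD => sD _; have [le_D _] := IH _ D1w sD.
rewrite size_rcons; split=> // _; exists x; first by rewrite mem_cat mem_head orbT.
by rewrite /= xy has_rcons /= leqnn.
Qed.

(** * Hook shape in terms of monotone subsequences *)

Definition monotone_pair (w : seq nat) (k l : nat) : Prop :=
  exists I D : seq nat, [/\ subseq I w, sorted ltn I & size I = k] /\
              [/\ subseq D w, sorted gtn D & size D = l].

(** An increasing and a decreasing subsequence of a word with distinct letters share at most one
    letter, so [k + l] is at most [size w + 1]. This is the case where that maximum is not
    attained. *)
Definition short_monotone_pairs (w : seq nat) : Prop :=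
  forall k l, monotone_pair w k l -> k + l <= size w.

(** The two lengths add up to [size w + 1], the value excluded by [short_monotone_pairs]. *)
Lemma hooked_monotone_pair w r L b :
  hooked w r L b -> monotone_pair w (size r) (size L).+1.
Proof.
move=> hw; have [D [z [Dw sD szD _]]] := hooked_decreasing hw.
have r_gt0 : 0 < size r by have [_ _ [c cr _]] := hooked_sorted hw; case: (r) cr.
have lt_p : (size r).-1 < size r by rewrite prednK.
have [J [Jw sJ szJ]] := hooked_increasing hw lt_p.
by exists (rcons J (nth 0 r (size r).-1)), (rcons D z);
  rewrite !size_rcons szJ szD prednK.
Qed.

Lemma hooked_lis w r L b : hooked w r L b -> lis w = size r.
Proof.
move=> hw; apply/eqP; rewrite eqn_leq; apply/andP; split.
  apply/bigmax_leqP => m sm.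
  by have [] := hooked_increasing_max hw (mask_subseq _ _) sm.
have [J [_ [[/subseqP[m szm ->] sJ <-] _]]] := hooked_monotone_pair hw.
have szm' : size m == size w by rewrite szm.
exact: (@leq_bigmax_cond _ _ (fun m : (size w).-tuple bool => size (mask m w))
  (Tuple szm') sJ).
Qed.

(* If both bounds grew, maximal [I] and [D] would be disjoint, cover [w] and
   extend by [x]; but the last letter [q] of [w] lies in one of them and, as
   [I < x < D], extends the other, contradicting maximality. *)
Lemma short_monotone_pairs_rcons w x : uniq (rcons w x) -> w != [::] ->
  short_monotone_pairs w -> short_monotone_pairs (rcons w x).
Proof.
have [tr tr'] := (ltn_trans, gtn_trans).
move=> uw w_n0 dw k l [I [D [[Iw sI <-] [Dw sD <-]]]] {k l}.
have bound (J E : seq nat) : subseq J w -> sorted ltn J -> subseq E w -> sorted gtn E ->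
    size J + size E <= size w.
  by move=> Jw sJ Ew sE; apply: dw; exists J, E.
rewrite size_rcons.
case/subseq_rconsP: Iw sI => [Iw sI|[I1 -> Iw]]; last rewrite sorted_rconsE //.
  case/subseq_rconsP: Dw sD => [Dw sD|[D1 -> Dw]]; last rewrite sorted_rconsE //.
    exact: leqW (bound _ _ Iw sI Dw sD).
  by case/andP=> sD _; rewrite size_rcons addnS ltnS; apply: bound.
case/andP=> sI I_x; rewrite size_rcons.
case/subseq_rconsP: Dw sD => [Dw sD|[D1 -> Dw]].
  by rewrite addSn ltnS; apply: bound.
rewrite sorted_rconsE // => /andP[sD D_x]; rewrite size_rcons addSn addnS !ltnS.
have := bound _ _ Iw sI Dw sD; rewrite leq_eqVlt => /predU1P[eq_w|//].
case/lastP: w => [|w q] // in uw w_n0 dw Iw Dw bound eq_w *.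
have uIDw : uniq (I1 ++ D1).
  rewrite cat_uniq ltn_sorted_uniq ?gtn_sorted_uniq // andbT /=.
  apply/hasPn => t /(allP D_x) /= xt; apply: contraL xt => /(allP I_x) /=.
  by rewrite -leqNgt => /ltnW.
have sub_ID : {subset I1 ++ D1 <= rcons w q}.
  by move=> t; rewrite mem_cat => /orP[/(mem_subseq Iw)|/(mem_subseq Dw)].
have : q \in I1 ++ D1.
  rewrite (uniq_min_size uIDw sub_ID _).2 ?mem_rcons ?mem_head //.
  by rewrite size_cat eq_w.
have qw : q \notin w by move: uw; rewrite !rcons_uniq => /andP[_ /andP[]].
rewrite mem_cat => /orP[qI|qD].
  suff : size I1 + size (rcons D1 q) <= size (rcons w q).
    by rewrite size_rcons addnS eq_w ltnn.
  have Dw' : subseq D1 w.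
    case/subseq_rconsP: Dw => // -[D' def_D _].
    have qD : q \in D1 by rewrite def_D mem_rcons mem_head.
    by have := ltn_trans (allP I_x q qI) (allP D_x q qD); rewrite ltnn.
  apply: bound => //; first exact: subseq_rcons_rcons.
  rewrite sorted_rconsE // sD; apply/allP => t /(allP D_x).
  exact: ltn_trans (allP I_x q qI).
suff : size (rcons I1 q) + size D1 <= size (rcons w q).
  by rewrite size_rcons addSn eq_w ltnn.
have Iw' : subseq I1 w.
  case/subseq_rconsP: Iw => // -[I' def_I _].
  have qI : q \in I1 by rewrite def_I mem_rcons mem_head.
  by have := ltn_trans (allP I_x q qI) (allP D_x q qD); rewrite ltnn.
apply: bound => //; first exact: subseq_rcons_rcons.
rewrite sorted_rconsE // sI; apply/allP => t /(allP I_x) tx.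
exact: ltn_trans tx (allP D_x q qD).
Qed.

(** Consider the first insertion that leaves the hooks: it bumps some [y] above the head [c] of the
    leg. Then [y] joins [c] in the second row, and neither maximal length grows while the word does.
    Both effects persist under later insertions. The second alternative keeps both, one to refute
    hook shape and one that can be tested on the inverse. *)
Lemma hooked_or_short w : uniq w -> w != [::] ->
  (exists r L b, hooked w r L b) \/
  short_monotone_pairs w /\ 1 < nth 0 (shape (insertion w)) 1.
Proof.
have tr := ltn_trans.
elim/last_ind: w => // w x IH uwx _.
have [->|w_n0] := eqVneq w [::].
  by left; exists [:: x], [::], [::]; apply: HookStart.
have /andP[xw uw] : (x \notin w) && uniq w by rewrite -rcons_uniq.
case: (IH uw w_n0) => [[r [L [b hw]]]|[dw row2]]; last first.
  right; split; first exact: short_monotone_pairs_rcons.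
  rewrite insertion_rcons; exact: leq_trans row2 (shape_tab_insert_mono _ _ _).
have xr : x \notin r.
  by apply: contra xw; rewrite (hooked_mem _ hw) => ->.
case: (row_insertP xr) => [r_x|r1 y r2 def_r r1_x xy].
  by left; exists (rcons r x), L, (rcons b true); apply: HookAppend.
rewrite {}def_r {r xr} in hw.
have [yL|yNL] := boolP (path ltn y L).
  by left; exists (r1 ++ x :: r2), (y :: L), (rcons b false); apply: HookBump.
have [sr sL _] := hooked_sorted hw.
case: L => [|c L] // in hw yNL sL *.
have cy : c < y.
  move: yNL; rewrite /= (_ : path ltn c L) // andbT -leqNgt leq_eqVlt.
  case/predU1P=> // eq_cy; move: (hooked_uniq hw).
  rewrite (perm_uniq (hooked_perm hw)) eq_cy cat_uniq /=.
  by rewrite mem_cat mem_head orbT /= andbF.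
right; split.
  move=> _ _ [J [D [[Jw sJ <-] [Dw sD <-]]]].
  rewrite size_rcons (hooked_size hw).
  suff le_J : size J <= size (r1 ++ y :: r2).
    suff : size D <= (size (c :: L)).+1 by rewrite -addnS; apply: leq_add.
    have upper (E : seq nat) := @hooked_decreasing_max _ _ _ _ E hw.
    case/subseq_rconsP: Dw sD => [Dw /(upper _ Dw)[]|[D' -> Dw]]; first by [].
    rewrite sorted_rconsE; last exact: gtn_trans.
    case/andP=> /(upper _ Dw)[le_D ex_z] /allP D_x; rewrite size_rcons ltnS.
    move: le_D; rewrite leq_eqVlt => /predU1P[/ex_z[z zr [zL /hasP[d dD /= dz]]]|//].
    have /= xd := D_x d dD; case/andP: zL => zc _.
    (* If [x] extended a longest decreasing subsequence, the row entry [z] would lie strictly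
       between [x] and the entry [y] that [x] bumps, where the row has nothing. *)
    have [xz zy] := (leq_trans xd dz, ltn_trans zc cy).
    move: zr; rewrite mem_cat inE => /or3P[/(allP r1_x)/= zx|/eqP eq_zy|].
    - by have := ltn_trans xz zx; rewrite ltnn.
    - by rewrite eq_zy ltnn in zy.
    by move/(allP (hooked_row_bump hw r1_x xy)); rewrite leqNgt zy.
  have upper (E : seq nat) := @hooked_increasing_max _ _ _ _ E hw.
  case/subseq_rconsP: Jw sJ => [Jw /(upper _ Jw)[]//|[J' -> Jw]].
  rewrite sorted_rconsE // => /andP[/(upper _ Jw)[le_J ex_j] /allP J_x].
  move: le_J; rewrite size_rcons leq_eqVlt => /predU1P[/ex_j[j jJ jr]|//].
  have := allP jr y; rewrite mem_cat mem_head orbT => /(_ isT) /=.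
  move=> yj; have /= jx := J_x j jJ.
  by have := leq_trans (ltn_trans jx xy) yj; rewrite ltnn.
rewrite insertion_rcons (hooked_insertion hw) /= row_insert_bump //=.
by rewrite (_ : y < c = false) // ltnNge ltnW.
Qed.

(** * Reversing the insertion *)

Lemma hooked_neq0 w r L b : hooked w r L b -> w != [::].
Proof. by case=> // *; rewrite -size_eq0 size_rcons. Qed.

(** The entries below the leg are exactly those whose bumping keeps a hook; as the last letter
    dominates them, such a bump is always a descent of the word. *)
Lemma last_letter_row w r L b : hooked w r L b ->
  last 0 w \in r /\ {in r, forall t, path ltn t L -> t <= last 0 w}.
Proof.
elim=> {w r L b} [x|w r L b x _ _ r_x _|w r1 y r2 L b x hw _ r1_x xy _ _].
- by rewrite mem_head; split=> // t; rewrite inE => /eqP->.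
- rewrite last_rcons mem_rcons mem_head; split=> // t.
  by rewrite mem_rcons inE => /predU1P[->//|/(allP r_x)/ltnW].
rewrite last_rcons mem_cat mem_head orbT; split=> // t.
rewrite mem_cat inE => /or3P[/(allP r1_x)/ltnW//|/eqP->//|t_r2] /andP[/= ty _].
by have := allP (hooked_row_bump hw r1_x xy) t t_r2; rewrite leqNgt ty.
Qed.

(** An appended letter exceeds the whole row, which contains the previous letter. A bumping letter
    is below the bumped entry, which is at most the previous letter. *)
Lemma hooked_ascents w r L b : hooked w r L b ->
  b = pairmap ltn (head 0 w) (behead w).
Proof.
have pairmapS x w' : w' != [::] -> pairmap ltn (head 0 (rcons w' x)) (behead (rcons w' x))
    = rcons (pairmap ltn (head 0 w') (behead w')) (last 0 w' < x).
  by case: w' => //= a w' _; rewrite -cats1 pairmap_cat cats1.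
elim=> {w r L b} [x|w r L b x hw IH r_x _|w r1 y r2 L b x hw IH r1_x xy yL _] //.
  rewrite pairmapS ?(hooked_neq0 hw) // -IH; congr rcons; apply/esym.
  by have [/(allP r_x)] := last_letter_row hw.
rewrite pairmapS ?(hooked_neq0 hw) // -IH; congr rcons; apply/esym/negbTE.
rewrite -leqNgt; apply: leq_trans (ltnW xy) _.
by have [_] := last_letter_row hw; apply; rewrite // mem_cat mem_head orbT.
Qed.

(** Adjacency of [v] and [v'] is taken relative to the letters of [w], because the induction runs
    over prefixes, which need not be permutations; it passes to a shorter prefix. The cases ask
    which of the two values is the new letter [x]. *)
Lemma hooked_leg w r L b v v' : hooked w r L b -> v \in w -> v' \in w ->
  v < v' -> {in w, forall u, ~~ (v < u < v')} ->
  (v' \in L) = (index v' w < index v w).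
Proof.
have index_rconsl (w' : seq nat) x z : z \in w' -> index z (rcons w' x) = index z w'.
  by rewrite -cats1 index_cat => ->.
have index_last (w' : seq nat) x : x \notin w' -> index x (rcons w' x) = size w'.
  by rewrite -cats1 index_cat /= eqxx addn0 => /negPf->.
move=> h; elim: h v v' => {w r L b} [x|w r L b x hw IH r_x xw
    |w r1 y r2 L b x hw IH r1_x xy yL xw] v v'.
- by rewrite !inE => /eqP-> /eqP->; rewrite ltnn.
- rewrite !(mem_rcons, inE) => /predU1P[->|vw] /predU1P[->|v'w] lt_v gap.
  + by rewrite ltnn in lt_v.
  + rewrite (index_rconsl _ _ _ v'w) index_last // index_mem v'w.
    move: v'w; rewrite (hooked_mem _ hw) => /orP[/(allP r_x)|->//].
    by rewrite /= ltnNge ltnW.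
  + rewrite (index_rconsl _ _ _ vw) index_last // ltnNge ltnW ?index_mem //=.
    by apply: contraNF xw; rewrite (hooked_mem _ hw) => ->; rewrite orbT.
  rewrite !index_rconsl //; apply: IH => // u uw; apply: gap.
  by rewrite mem_rcons inE uw orbT.
have yw : y \in w by rewrite (hooked_mem _ hw) mem_cat mem_head orbT.
rewrite !(mem_rcons, inE) => /predU1P[->|vw] /predU1P[->|v'w] lt_v gap.
- by rewrite ltnn in lt_v.
- rewrite (index_rconsl _ _ _ v'w) index_last // index_mem v'w.
  (* The letter just above [x] in value is the one bumped: smaller row entries are below [x], and
     all other letters are above [y]. *)
  suff -> : v' = y by rewrite eqxx.
  have := gap y; rewrite mem_rcons inE yw orbT xy /= -leqNgt => /(_ isT).
  rewrite leq_eqVlt => /predU1P[//|v'y]; move: v'w.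
  rewrite (hooked_mem _ hw) mem_cat inE -!orbA.
  have yr2 := hooked_row_bump hw r1_x xy.
  case/or4P=> [/(allP r1_x)|/eqP//|/(allP yr2)|] /=.
  + by rewrite ltnNge ltnW.
  + by rewrite leqNgt v'y.
  by move/(allP (order_path_min ltn_trans yL)) => /=; rewrite ltnNge ltnW.
- rewrite (index_rconsl _ _ _ vw) index_last // ltnNge ltnW ?index_mem //=.
  rewrite ltn_eqF //=; apply: contraNF xw; rewrite (hooked_mem _ hw) => ->.
  by rewrite orbT.
rewrite !index_rconsl //; have [eq_v'|_] /= := eqVneq v' y; last first.
  by apply: IH => // u uw; apply: gap; rewrite mem_rcons inE uw orbT.
(* If the bumped [y] were [v'], the letters below [y] would all be in [r1], hence below [x], and [x]
   would fall between [v] and [v']. *)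
have vx : v < x.
  rewrite ltn_neqAle; apply/andP; split; first by apply: contraNneq xw => <-.
  rewrite leqNgt; apply: contraT => /negbNE xv; rewrite eq_v' in lt_v.
  have yr2 := hooked_row_bump hw r1_x xy.
  move: vw; rewrite (hooked_mem _ hw) mem_cat inE -!orbA.
  case/or4P=> [/(allP r1_x)|/eqP eq_vy|/(allP yr2)|] /=.
  + by rewrite ltnNge ltnW.
  + by rewrite eq_vy ltnn in lt_v.
  + by rewrite leqNgt lt_v.
  by move/(allP (order_path_min ltn_trans yL)) => /=; rewrite ltnNge ltnW.
by have := gap x; rewrite mem_rcons mem_head vx eq_v' xy => /(_ isT).
Qed.

(** This is uniqueness in undoing a bump: once [y] is known, the inserted letter must be the largest
    row entry below [y], the last one kept by filtering. *)
Lemma split_row_inj r1 r1' r2 r2' x x' y :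
  r1 ++ x :: r2 = r1' ++ x' :: r2' ->
  sorted ltn (r1 ++ y :: r2) -> sorted ltn (r1' ++ y :: r2') ->
  x < y -> x' < y -> [/\ r1 = r1', x = x' & r2 = r2'].
Proof.
have filter_lt s1 s2 z : sorted ltn (s1 ++ y :: s2) -> z < y ->
    [seq t <- s1 ++ z :: s2 | t < y] = rcons s1 z.
  rewrite sorted_cat_mid; last exact: ltn_trans.
  case/and5P=> _ _ s1y ys2 _ zy; rewrite filter_cat /= zy.
  rewrite (all_filterP s1y) -[in RHS](cats1 s1); congr (_ ++ _ :: _).
  by apply/eqP; rewrite -[_ == _]negbK -has_filter -all_predC; apply: sub_all ys2 => t /=;
    rewrite -leqNgt => /ltnW.
move=> eq_r s_y s_y' xy x'y; have := congr1 (filter (gtn y)) eq_r.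
rewrite !filter_lt // => /rcons_inj[eq_r1 eq_x]; split=> //.
by move/eqP: eq_r; rewrite eq_r1 eq_x eqseq_cat // eqxx eqseq_cons eqxx => /eqP.
Qed.

Lemma hooked_last_inv w r L b a : hooked w r L (rcons b a) ->
  if a then exists w0 r0 x, [/\ w = rcons w0 x, r = rcons r0 x & hooked w0 r0 L b]
  else exists w0 r1 y r2 L0 x, [/\ w = rcons w0 x, r = r1 ++ x :: r2, L = y :: L0,
    x < y & hooked w0 (r1 ++ y :: r2) L0 b].
Proof.
move def_b' : (rcons b a) => b' h.
case: h def_b' => [x|w0 r0 L0 b0 x h0 _ _|w0 r1 y r2 L0 b0 x h0 _ xy _ _].
- by case: (b).
- by case/rcons_inj=> -> ->; exists w0, r0, x.
by case/rcons_inj=> -> ->; exists w0, r1, y, r2, L0, x.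
Qed.

(** The last bit of [b] names the rule applied last. An append is undone by dropping the end of the
    row, a bump by returning the head of the leg to its only possible place. *)
Lemma hooked_inj w w' r L b : hooked w r L b -> hooked w' r L b -> w = w'.
Proof.
move=> h; elim: h w' => {w r L b} [x|w r L b x hw IH _ _
    |w r1 y r2 L b x hw IH r1_x xy yL _] w' h'.
- have /hooked_perm /= p' := h'; have := perm_size p'; case: w' p' {h'} => [|z []] //.
  by move/perm_mem/(_ z); rewrite mem_head inE => /esym/eqP->.
- have [w0 [r0 [x0 [-> /rcons_inj[eq_r ->] h0]]]] := hooked_last_inv h'.
  by congr rcons; apply: IH; rewrite eq_r.
have [w0 [s1 [y' [s2 [L0 [x0 [-> eq_r [eq_y eq_L] xy' h0]]]]]]] := hooked_last_inv h'.
rewrite -{}eq_y -{}eq_L {y' L0} in xy' h0.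
have [sr _ _] := hooked_sorted hw; have [sr' _ _] := hooked_sorted h0.
have [eq_r1 -> eq_r2] := split_row_inj eq_r sr sr' xy xy'.
by congr rcons; apply: IH; rewrite eq_r1 eq_r2.
Qed.

Lemma sorted_split y r : sorted ltn r ->
  r = [seq t <- r | t < y] ++ [seq t <- r | y <= t].
Proof.
elim: r => //= x r IH xr; have sr := path_sorted xr.
case: ltnP => [_|yx] /=; first by rewrite -IH.
have gt_r : all (leq y) r.
  by apply: sub_all (order_path_min ltn_trans xr) => t /ltnW; apply: leq_trans.
rewrite (all_filterP gt_r); suff -> : [seq t <- r | t < y] = [::] by [].
apply/eqP; rewrite -[_ == _]negbK -has_filter -all_predC; apply: sub_all gt_r => t.
by rewrite /= leqNgt.
Qed.

(** The rules are run backwards along [b]. The entry [c] below the leg guarantees that the head of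
    the leg has a row entry to displace. *)
Lemma hooked_exists r L b : sorted ltn r -> sorted ltn L -> uniq (r ++ L) ->
  (exists2 c, c \in r & path ltn c L) ->
  size r = (count id b).+1 -> size L = count negb b ->
  exists w, hooked w r L b.
Proof.
have tr := ltn_trans.
elim/last_ind: b r L => [|b a IH] r L sr sL urL [c cr cL].
  case: r sr urL {c cr cL} => [|x []] // _ _ _ /size0nil->.
  by exists [:: x]; apply: HookStart.
rewrite -cats1 !count_cat /= !addn0 cats1; case: a => /=.
  rewrite addn1 addn0 => sz_r sz_L; case/lastP: r => [|r x] // in sr urL cr sz_r *.
  move: sr; rewrite sorted_rconsE // => /andP[sr r_x].
  case: sz_r; rewrite size_rcons => -[sz_r].
  have [xrL urL'] : x \notin r ++ L /\ uniq (r ++ L).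
    by apply/andP; rewrite -[_ && _]/(uniq (x :: r ++ L)) -cat_cons
      -(perm_uniq (_ : perm_eq (rcons r x ++ L) _)) // perm_cat2r perm_rcons.
  have [|w hw] := IH r L sr sL urL' _ sz_r sz_L.
    (* If the removed [x] was the witness itself, the head of the remaining row replaces it; by the
       count of [b] that row is not empty. *)
    move: cr; rewrite mem_rcons inE => /predU1P[eq_cx|cr]; last by exists c.
    case: (r) r_x sz_r => // z r' /andP[zx _] _; exists z; first exact: mem_head.
    case: (L) cL => //= t L' /andP[ct ->].
    by rewrite eq_cx in ct; rewrite (ltn_trans zx ct).
  exists (rcons w x); apply: HookAppend => //.
  by rewrite (perm_mem (hooked_perm hw)).
rewrite addn1 addn0 => sz_r; case: L => [|y L] // in sL urL cL * => -[sz_L].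
have cy : c < y by have /andP[] := cL.
have yNr : y \notin r.
  by apply/negP => yr; move: urL; rewrite cat_uniq /= yr /= andbF.
have def_r := sorted_split y sr; have := filter_all (gtn y) r; rewrite /=.
have: has (gtn y) r by apply/hasP; exists c.
rewrite has_filter; move: def_r; rewrite /=.
case/lastP: [seq t <- r | t < y] => // r1 x; rewrite cat_rcons.
have: all (leq y) [seq t <- r | y <= t] by apply: filter_all.
move: [seq t <- r | y <= t] => r2 yr2 def_r _; rewrite all_rcons => /andP[/= xy r1y].
have [xrL urL'] : x \notin (r1 ++ y :: r2) ++ L /\ uniq ((r1 ++ y :: r2) ++ L).
  apply/andP; rewrite -[_ && _]/(uniq (x :: (r1 ++ y :: r2) ++ L)).
  rewrite -(perm_uniq (_ : perm_eq (r ++ y :: L) _)) //; apply/seq.permP => p.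
  by rewrite def_r /= !count_cat /=; lia.
move: sr; rewrite def_r sorted_cat_mid // => /and5P[sr1 sr2 r1x xr2 r12].
have [|||w hw] := IH (r1 ++ y :: r2) L _ (path_sorted sL) urL' _ _ sz_L.
- rewrite sorted_cat_mid // sr1 sr2 r1y r12 andbT /=.
  apply/allP => t tr2 /=; rewrite ltn_neqAle (allP yr2 t tr2) andbT.
  by apply: contraNneq yNr => ->; rewrite def_r mem_cat inE tr2 !orbT.
- by exists y => //; rewrite mem_cat mem_head orbT.
- by rewrite -sz_r def_r !size_cat.
exists (rcons w x); apply: (HookBump hw) => //.
by rewrite (perm_mem (hooked_perm hw)).
Qed.

(** * Hook permutations and their descent sets *)

Lemma hooked_count w r L b : hooked w r L b ->
  size r = (count id b).+1 /\ size L = count negb b.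
Proof.
elim=> {w r L b} [x|w r L b x _ [szr szL] _ _|w r1 y r2 L b x _ [szr szL] _ _ _ _] //.
  by rewrite -!cats1 !size_cat !count_cat /= szr szL !addn0 !addn1.
by rewrite -!cats1 !count_cat -szL /= !addn0 addn1 -szr !size_cat /=.
Qed.

Lemma size_one_line n (s : 'S_n) : size (one_line s) = n.
Proof. by rewrite size_map size_enum_ord. Qed.

Lemma nth_one_line n (s : 'S_n) (i : 'I_n) : nth 0 (one_line s) i = (s i).+1.
Proof. by rewrite (nth_map i) ?size_enum_ord // nth_ord_enum. Qed.

Lemma one_line_uniq n (s : 'S_n) : uniq (one_line s).
Proof.
by rewrite map_inj_uniq ?enum_uniq // => i j [] /val_inj/perm_inj.
Qed.

Lemma mem_one_line n (s : 'S_n) v : (v \in one_line s) = (0 < v <= n).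
Proof.
apply/mapP/andP => [[i _ ->]|[]] //; case: v => // v _ lt_v.
exists ((s^-1)%g (Ordinal lt_v)); first by rewrite mem_enum.
by rewrite permKV.
Qed.

Lemma one_line_inj n : injective (@one_line n).
Proof.
move=> s t eq_st; apply/permP => i; apply/val_inj/succn_inj.
by rewrite -!nth_one_line eq_st.
Qed.

Lemma index_one_line n (s : 'S_n) (j : 'I_n) :
  index j.+1 (one_line s) = (s^-1)%g j.
Proof.
rewrite -[j in LHS](permKV s) (index_map (f := fun i => (s i : nat).+1)).
  by rewrite index_enum_ord.
by move=> i k [] /val_inj/perm_inj.
Qed.

Lemma one_line_surj n w : perm_eq w (iota 1 n) -> exists s : 'S_n, one_line s = w.
Proof.
case: n => [|n] wP.
  exists 1%g; rewrite (perm_small_eq _ wP) //.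
  by apply: size0nil; rewrite size_one_line.
have szw : size w = n.+1 by rewrite (perm_size wP) size_iota.
have w_ltn (i : 'I_n.+1) : 0 < nth 0 w i <= n.+1.
  by have := mem_nth 0 (_ : i < size w); rewrite szw (perm_mem wP) mem_iota => ->.
have f_val (i : 'I_n.+1) : (inord (nth 0 w i).-1 : 'I_n.+1).+1 = nth 0 w i.
  by case: (nth 0 w i) (w_ltn i) => //= v le_v; rewrite inordK.
have inj_f : injective (fun i : 'I_n.+1 => inord (nth 0 w i).-1 : 'I_n.+1).
  move=> i j /(congr1 (fun k : 'I_n.+1 => k.+1)); rewrite !f_val => eq_ij.
  have uw : uniq w by rewrite (perm_uniq wP) iota_uniq.
  have lt_w (k : 'I_n.+1) : k < size w by rewrite szw.
  by apply/val_inj/eqP; rewrite -(nth_uniq 0 (lt_w i) (lt_w j) uw) eq_ij.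
exists (perm inj_f); apply: (@eq_from_nth _ 0) => [|i]; rewrite size_one_line ?szw //.
by move=> lt_i; rewrite (nth_one_line _ (Ordinal lt_i)) permE f_val.
Qed.

(** * Invariance of hook shape under inversion *)

(** Subsequences become sets of positions, on which passing to the inverse permutation is simply
    taking the image under [s]. *)
Lemma subseq_one_line_set n (s : 'S_n) (e : rel nat) k : transitive e ->
  (exists J, [/\ subseq J (one_line s), sorted e J & size J = k]) <->
  (exists2 I : {set 'I_n}, #|I| = k &
     {in I &, forall i j : 'I_n, i < j -> e (s i).+1 (s j).+1}).
Proof.
move=> e_tr; pose lt_ord := relpre (@nat_of_ord n) ltn.
have lt_tr : transitive lt_ord by move=> ? ? ?; apply: ltn_trans.
have s_enum : sorted lt_ord (enum 'I_n).
  by have := iota_ltn_sorted 0 n; rewrite -val_enum_ord sorted_map.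
split=> [[J [/subseqP[m szm ->] sJ <-]]|[I <- sI]].
  move: sJ; rewrite -map_mask sorted_map => sJ.
  exists [set i in mask m (enum 'I_n)].
    by rewrite cardsE (card_uniqP _) ?mask_uniq ?enum_uniq // size_map.
  have s_mask := subseq_sorted lt_tr (mask_subseq m _) s_enum.
  have trJ : transitive (relpre (fun i => (s i).+1) e) by move=> ? ? ?; apply: e_tr.
  move=> i j; rewrite !inE => iI jI ij; apply: (sorted_ltn_index trJ sJ) => //.
  rewrite ltnNge leq_eqVlt; apply/negP => /predU1P[|/(sorted_ltn_index lt_tr s_mask)].
    by move/(index_inj i jI iI) => eq_ij; rewrite eq_ij ltnn in ij.
  by move/(_ jI iI); rewrite /lt_ord /= ltnNge ltnW.
have I_enum : subseq (enum I) (enum 'I_n).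
  by rewrite {1}/enum_mem -enumT filter_subseq.
exists [seq (s i).+1 | i <- enum I]; split.
- exact: map_subseq.
- rewrite sorted_map.
  apply: (@sub_in_sorted _ (mem I) lt_ord); first exact: sI.
    by apply/allP => i; rewrite mem_enum.
  exact: (subseq_sorted lt_tr I_enum s_enum).
by rewrite size_map cardE.
Qed.

Lemma monotone_pair_inv n (s : 'S_n) k l :
  monotone_pair (one_line s) k l -> monotone_pair (one_line (s^-1)%g) k l.
Proof.
have tr := ltn_trans; have tr' := gtn_trans.
case=> I [D [sI sD]].
have /(subseq_one_line_set _ _ tr)[{I sI}I cI sI] : exists J,
  [/\ subseq J (one_line s), sorted ltn J & size J = k] by exists I.
have /(subseq_one_line_set _ _ tr')[{D sD}D cD sD] : exists J,
  [/\ subseq J (one_line s), sorted gtn J & size J = l] by exists D.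
have [|J ?] := (subseq_one_line_set (s^-1)%g k tr).2; first exists (s @: I).
- by rewrite card_imset //; apply: perm_inj.
- move=> _ _ /imsetP[i iI ->] /imsetP[j jI ->]; rewrite !permK => lt_s.
  rewrite /= ltnS ltnNge leq_eqVlt; apply/negP => /predU1P[/val_inj eq_ij|].
    by rewrite eq_ij ltnn in lt_s.
  by move/(sI _ _ jI iI); rewrite /= ltnS ltnNge ltnW.
have [|E ?] := (subseq_one_line_set (s^-1)%g l tr').2; first exists (s @: D).
- by rewrite card_imset //; apply: perm_inj.
- move=> _ _ /imsetP[i iD ->] /imsetP[j jD ->]; rewrite !permK => lt_s.
  rewrite /= ltnS ltnNge leq_eqVlt; apply/negP => /predU1P[/val_inj eq_ij|].
    by rewrite eq_ij ltnn in lt_s.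
  by move/(sD _ _ iD jD); rewrite /= ltnS ltnNge ltnW.
by exists J, E.
Qed.

Definition hook_perm (n k : nat) : {set 'S_n} :=
  [set s | (lis (one_line s) == k) && hook n (sh s)].

Lemma hook_permP n k (s : 'S_n) : 0 < n ->
  reflect (exists r L b, hooked (one_line s) r L b /\ size r = k)
          (s \in hook_perm n k).
Proof.
move=> n_gt0; rewrite inE; apply: (iffP andP) => [[/eqP lis_s hk]|].
  have w_n0 : one_line s != [::] by rewrite -size_eq0 size_one_line -lt0n.
  have [[r [L [b hw]]]|[_]] := hooked_or_short (one_line_uniq s) w_n0.
    by exists r, L, b; rewrite -(hooked_lis hw).
  (* Index 1 is the second row, of length at most one in a hook. *)
  rewrite -RS_insertion -/(sh s); case/existsP: hk => j /andP[_ /eqP->] /=.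
  by rewrite nth_nseq; case: ifP.
case=> r [L [b [hw sz_r]]]; rewrite (hooked_lis hw) sz_r; split=> //.
have sz_s := hooked_size hw; rewrite size_one_line in sz_s.
have r_gt0 : 0 < size r by rewrite (hooked_count hw).1.
have lt_r : size r < n.+1 by rewrite ltnS sz_s leq_addr.
apply/existsP; exists (Ordinal lt_r); rewrite r_gt0 /= /sh RS_insertion.
rewrite (hooked_insertion hw) /= {1}sz_s addKn; apply/eqP; congr (_ :: _).
by rewrite /shape -map_comp; elim: (L) => //= ? ? ->.
Qed.

(** The monotone pair with lengths summing to [n + 1] survives inversion, so the inverse is not
    short. It bounds the row and leg of the inverse from below, and equal totals force equality. *)
Lemma hook_perm_inv n k (s : 'S_n) : 0 < n ->
  s \in hook_perm n k -> (s^-1)%g \in hook_perm n k.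
Proof.
move=> n_gt0 /(hook_permP _ _ n_gt0)[r [L [b [hw sz_r]]]]; apply/hook_permP => //.
have w_n0 : one_line (s^-1)%g != [::] by rewrite -size_eq0 size_one_line -lt0n.
have cov := monotone_pair_inv (hooked_monotone_pair hw).
have sz_s := hooked_size hw; rewrite size_one_line in sz_s.
have [[r' [L' [b' hw']]]|[dw _]] := hooked_or_short (one_line_uniq _) w_n0.
  exists r', L', b'; split=> //.
  have [I [D [[Iw sI szI] [Dw sD szD]]]] := cov.
  have [le_I _] := hooked_increasing_max hw' Iw sI.
  have [le_D _] := hooked_decreasing_max hw' Dw sD.
  have sz_s' := hooked_size hw'; rewrite size_one_line in sz_s'.
  move: le_I le_D; rewrite {}szI {}szD -{}sz_r {n_gt0 w_n0 cov hw hw' Iw sI Dw sD}.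
  lia.
by have := dw _ _ cov; rewrite size_one_line addnS -sz_s ltnn.
Qed.

(** * Descent sets as coordinates on hook permutations *)

Definition descents n (s : 'S_n.+1) : {set 'I_n} :=
  [set i | s (lift ord0 i) < s (widen_ord (leqnSn n) i)].

Lemma hooked_descents n (s : 'S_n.+1) r L b : hooked (one_line s) r L b ->
  b = [seq i \notin descents s | i <- enum 'I_n].
Proof.
move=> hw; have szb : size b = n.
  have := hooked_size hw; rewrite size_one_line.
  have [-> ->] := hooked_count hw; have := count_predC id b.
  by rewrite addSn => -> [].
apply: (@eq_from_nth _ true) => [|i]; first by rewrite size_map size_enum_ord.
rewrite szb => lt_i; pose j := Ordinal lt_i.
rewrite (nth_map j) ?size_enum_ord // (nth_ord_enum j j) inE -leqNgt.
have nth_w k : k < n.+1 -> nth 0 (one_line s) k = (s (inord k)).+1.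
  by move=> lt_k; rewrite -{1}(inordK lt_k) nth_one_line.
rewrite [in LHS](hooked_ascents hw).
have -> : pairmap ltn (head 0 (one_line s)) (behead (one_line s))
  = [seq nth 0 (one_line s) k < nth 0 (one_line s) k.+1 | k <- iota 0 n].
  case: (one_line s) (size_one_line s) => //= x w [<-].
  elim: w x => //= y w IHw x; congr (_ :: _); rewrite IHw.
  by rewrite -[in RHS]add1n iotaDl -map_comp.
rewrite (nth_map 0) ?size_iota // nth_iota // add0n.
rewrite (nth_w i.+1 lt_i) (nth_w i (leqW lt_i)) ltnS.
rewrite ltn_neqAle; set a := s _; set c := s _.
have -> : s (widen_ord (leqnSn n) j) = a.
  by congr (s _); apply/val_inj; rewrite /= (inordK (leqW lt_i)).
have -> : s (lift ord0 j) = c.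
  by congr (s _); apply/val_inj; rewrite /= (inordK (lt_i : i.+1 < n.+1)).
suff /negPf -> : nat_of_ord a != c by [].
rewrite (inj_eq val_inj) (inj_eq perm_inj) -(inj_eq val_inj) /=.
by rewrite (inordK (leqW lt_i)) (inordK (lt_i : i.+1 < n.+1)) ltn_eqF.
Qed.

(** Indices start at 0 and letters at 1, so the adjacent positions [i] and [i + 1] of the inverse
    hold the places of the letters [i.+1] and [i.+2]. *)
Lemma hooked_inv_descents n (s : 'S_n.+1) r L b (i : 'I_n) :
  hooked (one_line s) r L b -> (i.+2 \in L) = (i \in descents (s^-1)%g).
Proof.
move=> hw; rewrite inE; pose j := widen_ord (leqnSn n) i.
rewrite (hooked_leg (v := i.+1) hw) ?mem_one_line ?ltnS //=.
- by rewrite (index_one_line s (lift ord0 i)) (index_one_line s j).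
- exact: ltnW.
by move=> u _; apply/negP => /andP[iu]; rewrite ltnS leqNgt iu.
Qed.

Lemma hooked_leg_gt1 n (s : 'S_n) r L b v :
  hooked (one_line s) r L b -> v \in L -> 1 < v.
Proof.
move=> hw vL; have [_ _ [c cr /(order_path_min ltn_trans)/allP/(_ v vL)]] :=
  hooked_sorted hw.
apply: leq_ltn_trans.
have : c \in one_line s by rewrite (hooked_mem _ hw) cr.
by rewrite mem_one_line => /andP[].
Qed.

Lemma count_enum_set (T : finType) (A : {set T}) : count (mem A) (enum T) = #|A|.
Proof. by rewrite enumT cardE /enum_mem size_filter. Qed.

Lemma card_descents n k (s : 'S_n.+1) :
  s \in hook_perm n.+1 k -> #|descents s| = n.+1 - k.
Proof.
case/hook_permP=> // r [L [b [hw <-]]].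
have := hooked_size hw; rewrite size_one_line => ->; rewrite addKn.
rewrite (hooked_count hw).2 (hooked_descents hw) count_map -count_enum_set.
by apply: eq_count => i /=; rewrite negbK.
Qed.

(** The descents of the inverse give the leg, its complement gives the row, and the descents of [s]
    give [b]; then [hooked_inj] recovers the word. *)
Lemma descents_inj n k :
  {in hook_perm n.+1 k &, injective (fun s => (descents (s^-1)%g, descents s))}.
Proof.
move=> s t /hook_permP[] // r [L [b [hw _]]] /hook_permP[] // r' [L' [b' [hw' _]]].
case=> eq_dV eq_d; apply: one_line_inj.
have [sr sL _] := hooked_sorted hw; have [sr' sL' _] := hooked_sorted hw'.
have disj r1 L1 b1 (s1 : 'S_n.+1) v : hooked (one_line s1) r1 L1 b1 ->
    (v \in r1) = (0 < v <= n.+1) && (v \notin L1).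
  move=> h1; have := hooked_uniq h1; rewrite (perm_uniq (hooked_perm h1)).
  rewrite -(mem_one_line s1) (hooked_mem _ h1) cat_uniq => /and3P[_ /hasPn r1L1 _].
  by case: (boolP (v \in L1)) => [/r1L1/negbTE->|]; rewrite ?andbF ?orbF ?andbT.
have eq_L : L = L'.
  apply: (irr_sorted_eq ltn_trans ltnn sL sL') => -[|[|v]].
  - by apply/idP/idP => [/(hooked_leg_gt1 hw)|/(hooked_leg_gt1 hw')].
  - by apply/idP/idP => [/(hooked_leg_gt1 hw)|/(hooked_leg_gt1 hw')].
  have [lt_v|le_v] := ltnP v n.
    by rewrite (hooked_inv_descents (Ordinal lt_v) hw)
      (hooked_inv_descents (Ordinal lt_v) hw') eq_dV.
  have notin L1 r1 b1 (s1 : 'S_n.+1) : hooked (one_line s1) r1 L1 b1 ->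
      v.+2 \notin L1.
    move=> h1; have := mem_one_line s1 v.+2; rewrite (hooked_mem _ h1) !ltnS.
    by rewrite ltnNge le_v; case: (_ \in L1); rewrite ?orbT.
  by rewrite (negbTE (notin _ _ _ _ hw)) (negbTE (notin _ _ _ _ hw')).
have eq_r : r = r'.
  apply: (irr_sorted_eq ltn_trans ltnn sr sr') => v.
  by rewrite (disj _ _ _ _ _ hw) (disj _ _ _ _ _ hw') eq_L.
apply: (hooked_inj hw); rewrite eq_r eq_L (hooked_descents hw) eq_d.
by rewrite -(hooked_descents hw').
Qed.

Lemma descents_surj n k (A B : {set 'I_n}) : 0 < k <= n.+1 ->
  #|A| = n.+1 - k -> #|B| = n.+1 - k ->
  exists2 s : 'S_n.+1, s \in hook_perm n.+1 k &
    descents (s^-1)%g = A /\ descents s = B.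
Proof.
case/andP=> k_gt0 le_kn cA cB; pose b := [seq i \notin B | i <- enum 'I_n].
(* [P] selects the future leg, with the shift by two of [hooked_inv_descents]. The letter 1 is never
   selected, so it is the row entry below the leg. *)
pose P (v : nat) := [exists i in A, v == i.+2].
have P_A (i : 'I_n) : P i.+2 = (i \in A).
  apply/existsP/idP => [[j /andP[jA]]|iA]; last by exists i; rewrite iA eqxx.
  by rewrite !eqSS => /eqP/val_inj->.
have P1 : P 1 = false by apply/existsP => -[j /andP[_]].
pose L := [seq v <- iota 1 n.+1 | P v]; pose r := [seq v <- iota 1 n.+1 | ~~ P v].
have rL : perm_eq (r ++ L) (iota 1 n.+1).
  by rewrite perm_catC; exact: permEl (perm_filterC P _).
have sz_L : size L = #|A|.
  rewrite size_filter /= P1 add0n (iotaDl 2 0) count_map -val_enum_ord count_map.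
  by rewrite -count_enum_set; apply: eq_count.
have cb : count negb b = #|B|.
  by rewrite count_map -count_enum_set; apply: eq_count => i /=; rewrite negbK.
have szb : size b = n by rewrite size_map size_enum_ord.
have sz_rL := perm_size rL; rewrite size_cat size_iota in sz_rL.
have sz_r : size r = k.
  by apply: (@addIn (n.+1 - k)); rewrite subnKC // -cA -sz_L.
have sz_Lb : size L = count negb b by rewrite sz_L cA cb cB.
have [|||||w hw] := @hooked_exists r L b _ _ _ _ _ sz_Lb.
- exact: (sorted_filter ltn_trans _ (iota_ltn_sorted _ _)).
- exact: (sorted_filter ltn_trans _ (iota_ltn_sorted _ _)).
- by rewrite (perm_uniq rL) iota_uniq.
- exists 1; first by rewrite mem_filter P1.
  rewrite path_sortedE; last exact: ltn_trans.
  rewrite (sorted_filter ltn_trans _ (iota_ltn_sorted _ _)) andbT.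
  by apply/allP => v; rewrite mem_filter => /andP[/existsP[j /andP[_ /eqP->]]].
- have := count_predC id b; rewrite szb (_ : count (predC id) b = #|B|) // cB sz_r.
  lia.
have [s def_w] := one_line_surj (perm_trans (hooked_perm hw) rL).
rewrite -def_w in hw; exists s; first by apply/hook_permP => //; exists r, L, b.
split; apply/setP => i.
  by rewrite -(hooked_inv_descents i hw) mem_filter P_A mem_iota add1n
    !ltnS ltn_ord /= andbT.
have /eq_in_map/(_ i) := hooked_descents hw.
by rewrite mem_enum => /(_ isT)/(congr1 negb); rewrite !negbK.
Qed.

(** * Cardinalities and log concavity *)

Lemma card_hook_perm n k : 0 < k <= n.+1 ->
  ell_hook n.+1 k = 'C(n, n.+1 - k) ^ 2.
Proof.
move=> k_n; rewrite /ell_hook -/(hook_perm n.+1 k).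
rewrite -(card_in_imset (@descents_inj n k)).
pose D := [set A : {set 'I_n} | #|A| == n.+1 - k].
rewrite (_ : _ @: _ = setX D D).
  by rewrite cardsX card_draws card_ord mulnn.
apply/setP => -[A B]; rewrite !inE; apply/imsetP/andP => [[s sX [-> ->]]|].
  by rewrite !(@card_descents _ k) ?hook_perm_inv.
case=> /eqP cA /eqP cB; have [s sX [dV d]] := descents_surj k_n cA cB.
by exists s; rewrite ?dV ?d.
Qed.

Lemma card_hook_involution n k : 0 < k <= n.+1 ->
  inv_hook n.+1 k = 'C(n, n.+1 - k).
Proof.
move=> k_n; rewrite /inv_hook; set X := [set s | _].
have XP s : (s \in X) = ((s^-1)%g == s) && (s \in hook_perm n.+1 k).
  by rewrite !inE eq_invg_mul.
have inj_d : {in X &, injective (@descents n)}.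
  move=> s t; rewrite !XP => /andP[/eqP sV sX] /andP[/eqP tV tX] eq_d.
  by apply: (descents_inj sX tX); rewrite sV tV eq_d.
rewrite -(card_in_imset inj_d).
rewrite (_ : _ @: _ = [set A : {set 'I_n} | #|A| == n.+1 - k]).
  by rewrite card_draws card_ord.
apply/setP => A; rewrite inE; apply/imsetP/eqP => [[s]|cA].
  by rewrite XP => /andP[_ /card_descents dX] ->.
(* With [A] prescribed for both descent sets, [s] and its inverse have the same coordinates, hence
   coincide. *)
have [s sX [dV d]] := descents_surj k_n cA cA; exists s => //.
rewrite XP sX andbT; apply/eqP; apply: (descents_inj _ sX); rewrite ?hook_perm_inv //.
by rewrite /= invgK dV d.
Qed.

(** Multiplying by [j.+2 * (m - j)] and using the ratio of consecutive binomials twice turns the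
    left side into [j.+1 * (m - j.+1)] times the square. *)
Lemma binomial_log_concave m j : 'C(m, j) * 'C(m, j.+2) <= 'C(m, j.+1) ^ 2.
Proof.
have [lt_jm|le_mj] := ltnP j m; last by rewrite (@bin_small _ j.+2) ?muln0 // ltnS leqW.
have e1 := mul_bin_left m j; have e2 := mul_bin_left m j.+1.
have gt0 : 0 < j.+2 * (m - j) by rewrite muln_gt0 subn_gt0.
rewrite -(leq_pmul2l gt0) -mulnn.
have -> : j.+2 * (m - j) * ('C(m, j) * 'C(m, j.+2))
    = j.+1 * (m - j.+1) * ('C(m, j.+1) * 'C(m, j.+1)).
  rewrite mulnCA; nia.
by rewrite leq_mul2r leq_mul ?orbT //; lia.
Qed.

Unset Implicit Arguments.
Import Order.TTheory GRing.Theory Num.Theory.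
Local Open Scope ring_scope.

Theorem theorem3p1 (R : realDomainType) (n : nat) (hn : (1 <= n)%N) :
  log_concave n (fun k : nat => (ell_hook n k)%:R : R) /\
  log_concave n (fun k : nat => (inv_hook n k)%:R : R).
Proof.
case: n hn => // n _.
(* The inequality is symmetric in its outer terms, so reversing the index preserves it; at both ends
   the padding makes the left side zero. *)
have lc (f g : nat -> nat) : (forall k, (0 < k <= n.+1)%N -> f k = g (n.+1 - k)%N) ->
    (forall j, g j * g j.+2 <= g j.+1 ^ 2)%N ->
    log_concave n.+1 (fun k => (f k)%:R : R).
  move=> fg g_lc [|[|k]] // /andP[_ le_k]; rewrite /pad /=.
    by rewrite mul0r sqr_ge0.
  rewrite (ltnW le_k) le_k; case: ifP => [lt_k|_]; last by rewrite mulr0 sqr_ge0.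
  rewrite -natrM -natrX ler_nat !fg ?(ltnW le_k) //=.
  have -> : (n.+1 - k.+1 = (n.+1 - k.+3).+2)%N by lia.
  have -> : (n.+1 - k.+2 = (n.+1 - k.+3).+1)%N by lia.
  by rewrite mulnC.
split.
  apply: (lc _ (fun j => 'C(n, j) ^ 2)%N) => [k k_n|j]; first exact: card_hook_perm.
  by rewrite -expnMn leq_sqr binomial_log_concave.
apply: (lc _ (fun j => 'C(n, j))%N) => [k k_n|j]; first exact: card_hook_involution.
exact: binomial_log_concave.
Qed.
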